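(* Let $0\le t<1$. The operator $C_t\in\mathcal{L}(h)$ is compact and has spectra $$\sigma_{pt}(C_t;h)=\Lambda\quad\text{and}\quad\sigma(C_t;h)=\Lambda_0.$$ Moreover, $C_t$ is power bounded and uniformly mean ergodic in $h$ but it is not supercyclic.
   Context: Sequences are complex and indexed by $\mathbb{N}_0=\{0,1,2,\dots\}$. The Hahn space $h$ is the Banach space of all $x\in c_0$ (null sequences) with $\|x\|_h:=\sum_{k=0}^\infty(k+1)|x_{k+1}-x_k|<\infty$. For $t\in[0,1]$ the generalized Cesàro operator is $C_tx=\big(\frac{t^nx_0+t^{n-1}x_1+\dots+x_n}{n+1}\big)_{n\in\mathbb{N}_0}$, with $t^0=1$ also for $t=0$. $\Lambda:=\{\frac1{n+1}:n\in\mathbb{N}_0\}$ and $\Lambda_0:=\Lambda\cup\{0\}$. $\mathcal{L}(X)$ is the space of bounded linear operators on a Banach space $X$; $\sigma(T;X)$ and $\sigma_{pt}(T;X)$ are the spectrum and point spectrum (set of eigenvalues) of $T$. With $T_{[n]}:=\frac1n\sum_{m=1}^nT^m$, $T$ is uniformly mean ergodic if $(T_{[n]})_{n\geq 1}$ converges in operator norm; power bounded if $\sup_{n\ge1}\|T^n\|<\infty$; supercyclic if there is $x\in X$ with $\{\lambda T^nx:\lambda\in\mathbb{C},n\in\mathbb{N}_0\}$ dense in $X$. *)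

(* Defs.v *)
From HB Require Import structures.
From mathcomp Require Import all_boot all_order all_algebra.
From mathcomp Require Import all_classical all_reals all_analysis.
From mathcomp Require Import complex.

Set Implicit Arguments.
Unset Strict Implicit.
Unset Printing Implicit Defensive.

Import Order.TTheory GRing.Theory Num.Theory.
Import numFieldNormedType.Exports.

Local Open Scope classical_set_scope.
Local Open Scope ring_scope.
Local Open Scope complex_scope.

Section BoundedOperators.
Context {R : realType} {V : normedModType R[i]}.
Implicit Types (T : V -> V) (l : R[i]).

(* The norm of [V] takes its values in [R[i]]; they are real, and this is the
   same number in [R]. *)
Definition rnorm (x : V) : R := complex.Re `|x|.

Definition bounded_operator T : Prop :=
  linear T /\ exists M : R, forall x, rnorm (T x) <= M * rnorm x.

(* Extended-real valued, so that it is [+oo] on unbounded maps. *)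
Definition opnorm T : \bar R :=
  ereal_sup [set (rnorm (T x))%:E | x in [set x : V | rnorm x <= 1]].

Definition compact_operator T : Prop :=
  precompact (T @` [set x : V | rnorm x <= 1]).

(* [S] is a two-sided inverse of [l - T] in the algebra of bounded operators. *)
Definition resolvent_set T : set R[i] :=
  [set l | exists S : V -> V, [/\ bounded_operator S,
     cancel (fun x => l *: x - T x) S & cancel S (fun x => l *: x - T x)]].

Definition spectrum T : set R[i] := ~` resolvent_set T.

Definition point_spectrum T : set R[i] :=
  [set l | exists2 x : V, x != 0 & T x = l *: x].

Definition power_bounded T : Prop :=
  (ereal_sup [set opnorm (iter n T) | n in [set n | (1 <= n)%N]] < +oo)%E.

Definition ergodic_mean T (n : nat) (x : V) : V :=
  n%:R^-1 *: \sum_(1 <= m < n.+1) iter m T x.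

Definition uniformly_mean_ergodic T : Prop :=
  exists2 P : V -> V, bounded_operator P &
    opnorm (fun x => ergodic_mean T n x - P x) @[n --> \oo] --> 0%E.

Definition supercyclic T : Prop :=
  exists x : V, dense [set y | exists l (n : nat), y = l *: iter n T x].

End BoundedOperators.

Lemma cvg0_scaleD (K : numFieldType) (W : normedModType K) (l : K)
    (u v : nat -> W) :
  u n @[n --> \oo] --> 0 -> v n @[n --> \oo] --> 0 ->
  (l *: u n + v n) @[n --> \oo] --> 0.
Proof.
move=> u0 v0; rewrite -[X in _ --> X]addr0 -[X in _ --> X + _](scaler0 _ l).
by apply: cvgD => //; exact: cvgZr.
Qed.

Section HahnSpace.
Variable R : realType.
Implicit Types (x y : nat -> R[i]).

Definition hahn_term x (k : nat) : R := k.+1%:R * Normc.normc (x k.+1 - x k).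

Definition hahn_space : set (nat -> R[i]) :=
  [set x | (x n : R[i]^o) @[n --> \oo] --> (0 : R[i]^o) /\
           cvgn (series (hahn_term x))].

(* Boolean form of [hahn_space], needed for the subtype machinery. *)
Definition hahn_pred : {pred nat -> R[i]} := mem hahn_space.

Lemma normc_ge0 (z : R[i]) : 0 <= Normc.normc z.
Proof. by case: z => a b; exact: sqrtr_ge0. Qed.

Lemma hahn_term_ge0 x k : 0 <= hahn_term x k.
Proof. by rewrite mulr_ge0// normc_ge0. Qed.

Lemma hahn_termD x y k : hahn_term (x + y) k <= hahn_term x k + hahn_term y k.
Proof.
rewrite /hahn_term -mulrDr ler_wpM2l//.
rewrite (_ : (x + y) k.+1 - (x + y) k = (x k.+1 - x k) + (y k.+1 - y k)).
  exact: le_normcD.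
by rewrite !fctE opprD addrACA.
Qed.

Lemma hahn_termZ (l : R[i]) x k :
  hahn_term (l *: x) k = Normc.normc l * hahn_term x k.
Proof.
rewrite /hahn_term mulrCA -Normc.normcM; congr (_ * Normc.normc _).
by rewrite mulrBr.
Qed.

Lemma is_cvg_hahn_termD x y :
  cvgn (series (hahn_term x)) -> cvgn (series (hahn_term y)) ->
  cvgn (series (hahn_term (x + y))).
Proof.
move=> cx cy; apply: (@series_le_cvg _ _ (hahn_term x + hahn_term y)).
- exact: hahn_term_ge0.
- by move=> k; rewrite addr_ge0// hahn_term_ge0.
- exact: hahn_termD.
- exact: is_cvg_seriesD.
Qed.

Lemma series_hahn_termZ (l : R[i]) x :
  series (hahn_term (l *: x)) = Normc.normc l *: series (hahn_term x).
Proof.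
apply/funext => n; rewrite !fctE /series /= scaler_sumr.
by apply: eq_bigr => k _; rewrite hahn_termZ.
Qed.

Lemma hahn_pred_submod : submod_closed hahn_pred.
Proof.
split=> [|l x y /set_mem[x0 cx] /set_mem[y0 cy]]; apply/mem_set; split.
- exact: cvg_cst.
- rewrite (_ : hahn_term 0 = cst 0); last first.
    by apply/funext => k; rewrite /hahn_term subrr Normc.normc0 mulr0.
  rewrite (_ : series _ = cst 0); first exact: is_cvg_cst.
  by apply/funext => n; rewrite /series /= big1.
- exact: (@cvg0_scaleD R[i] R[i]^o l x y x0 y0).
- apply: is_cvg_hahn_termD => //; rewrite series_hahn_termZ.
  exact: is_cvgZr.
Qed.

HB.instance Definition _ :=
  GRing.isSubmodClosed.Build R[i] (nat -> R[i]) hahn_pred hahn_pred_submod.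

Record hahn : predArgType := Hahn {
  hahn_seq :> nat -> R[i];
  _ : hahn_seq \in hahn_pred }.

HB.instance Definition _ := [isSub for hahn_seq].
HB.instance Definition _ := [Choice of hahn by <:].
HB.instance Definition _ := [SubChoice_isSubLmodule of hahn by <:].

Definition hahn_norm (x : hahn) : R[i] := (limn (series (hahn_term x)))%:C.

Lemma hahn_cvg0 (x : hahn) :
  ((x : nat -> R[i]) n : R[i]^o) @[n --> \oo] --> (0 : R[i]^o).
Proof. by case: x => x /= /set_mem[]. Qed.

Lemma hahn_is_cvg (x : hahn) : cvgn (series (hahn_term x)).
Proof. by case: x => x /= /set_mem[]. Qed.

Lemma hahn_normD (x y : hahn) : hahn_norm (x + y) <= hahn_norm x + hahn_norm y.
Proof.
rewrite /hahn_norm -rmorphD lecR.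
rewrite -lim_seriesD; [|exact: hahn_is_cvg..].
apply: lim_series_le => [||k]; last exact: hahn_termD.
- exact: (@hahn_is_cvg (x + y)).
- by apply: is_cvg_seriesD; exact: hahn_is_cvg.
Qed.

Lemma hahn_normZ (l : R[i]) (x : hahn) : hahn_norm (l *: x) = `|l| * hahn_norm x.
Proof.
rewrite /hahn_norm (series_hahn_termZ l x) limZr; last exact: hahn_is_cvg.
by rewrite rmorphM; case: l.
Qed.

Lemma hahn_norm0_eq0 (x : hahn) : hahn_norm x = 0 -> x = 0.
Proof.
move=> /complexI x0.
have term0 k : hahn_term x k = 0.
  apply/eqP; rewrite eq_le hahn_term_ge0 andbT -x0.
  apply: (@le_trans _ _ (series (hahn_term x) k.+1)).
    rewrite /series /= big_nat_recr//= lerDr sumr_ge0// => i _.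
    exact: hahn_term_ge0.
  apply: nondecreasing_cvgn_le; last exact: hahn_is_cvg.
  by apply: nondecreasing_series => i _ _; exact: hahn_term_ge0.
have cstx n : x n = x 0%N.
  elim: n => // n <-; apply/eqP; rewrite -subr_eq0; apply/eqP.
  by apply: Normc.eq0_normc; move/eqP: (term0 n); rewrite mulf_eq0 pnatr_eq0 => /eqP.
apply/val_inj/funext => n /=; rewrite cstx.
have := @hahn_cvg0 x; rewrite (_ : (fun n => _) = cst (x 0%N)); last first.
  exact/funext.
exact/(cvg_unique (@norm_hausdorff R[i] R[i]^o) (cvg_cst _)).
Qed.

HB.instance Definition _ :=
  Lmodule_isNormed.Build R[i] hahn hahn_normD hahn_normZ hahn_norm0_eq0.

End HahnSpace.

Section Cesaro.
Context {R : realType}.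

Definition cesaro_op (t : R) (x : nat -> R[i]) (n : nat) : R[i] :=
  (\sum_(i < n.+1) t%:C ^+ (n - i) * x i) / n.+1%:R.

Definition Lambda : set R[i] := [set n.+1%:R^-1 | n in [set: nat]].

Definition Lambda0 : set R[i] := Lambda `|` [set 0].

End Cesaro.

(* Main.v *)
Require Import Defs.
From HB Require Import structures.
From mathcomp Require Import all_boot all_order all_algebra.
From mathcomp Require Import all_classical all_reals all_analysis.
From mathcomp Require Import complex.
From mathcomp Require Import ring lra.

Set Implicit Arguments.
Unset Strict Implicit.
Unset Printing Implicit Defensive.

Import Order.TTheory GRing.Theory Num.Theory.
Import numFieldNormedType.Exports.

Local Open Scope classical_set_scope.
Local Open Scope ring_scope.

(* Truncating a sequence after index [n] has Hahn norm
   [p_n x = sum_(k < n) (k + 1) |x_{k+1} - x_k| + (n + 1) |x_n|], which increases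
   to [|x|]. Convolution with [(t^k)] is bounded for [p_n], uniformly in [n], and
   division by [k + 1] gains a factor [1 / (N + 1)] on the tail, so
   [p_n (C_t x) <= p_N (C_t x) + L / (N + 1) * p_n x]. Thus [C_t] is, up to an
   arbitrarily small operator, a lower triangular matrix with diagonal entries
   [1 / (k + 1)]. This reduces solving [l x - C_t x = y] and estimating the powers
   of [C_t] on [x_0 = 0] to finitely many coordinates, where one argues by
   induction, and it makes the image of the unit ball uniformly small at infinity,
   hence precompact. The eigenvectors are the [binom(n, m) t^(n - m)]. *)

(** * Truncated Hahn norms of arbitrary sequences *)

Section Estimates.
Variable R : realType.
Implicit Types (x y z : nat -> R[i]) (a b : R[i]).

Local Notation normc := Normc.normc.

Lemma normc_addr a b : normc (a + b) <= normc a + normc b.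
Proof. exact: le_normcD. Qed.

Lemma normc_subr a b : normc (a - b) <= normc a + normc b.
Proof. by rewrite -(normcN b) normc_addr. Qed.

Lemma normc_real (r : R) : normc (r%:C)%C = `|r|.
Proof. by rewrite /= expr0n addr0 sqrtr_sqr. Qed.

Lemma normc_nat n : normc (n%:R : R[i]) = n%:R.
Proof. by rewrite -(rmorph_nat (real_complex R)) normc_real ger0_norm. Qed.

Lemma exists_divn_le (c e : R) : 0 < e -> exists N, c / N.+1%:R <= e.
Proof.
move=> e0; exists (Num.trunc (c / e)).
by rewrite ler_pdivrMr// mulrC -ler_pdivrMr// ltW// truncnS_gt.
Qed.

(** The value [c / (1 - r)] is the fixed point of [s |-> r * s + c], and this increasing map keeps
    everything below it. The range stops at [n] because later uses control only the first
    coordinates. *)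
Lemma affine_recurrence_le (r c : R) (u : nat -> R) n :
  0 <= r < 1 -> u 0%N <= c / (1 - r) ->
  (forall k, (k < n)%N -> u k.+1 <= r * u k + c) ->
  forall k, (k <= n)%N -> u k <= c / (1 - r).
Proof.
move=> /andP[r0 r1] u0 uS; elim=> // k IH kn.
have r1_neq0 : 1 - r != 0 by lra.
have -> : c / (1 - r) = r * (c / (1 - r)) + c by field.
by rewrite (le_trans (uS _ kn))// lerD2r ler_wpM2l// IH// ltnW.
Qed.

(** The forcing decays more slowly than the contraction 1/2, so it dictates the rate;
    [4 * c = c / (3/4 - 1/2)] is the coefficient of the particular solution [(3 / 4) ^+ m]. *)
Lemma geometric_recurrence_le (c : R) (u : nat -> R) :
  0 <= c -> (forall m, 0 <= u m) ->
  (forall m, u m.+1 <= 2^-1 * u m + c * (3 / 4) ^+ m) ->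
  forall m, u m <= (u 0%N + 4 * c) * (3 / 4) ^+ m.
Proof.
move=> c0 u0 uS; elim=> [|m IH]; first by rewrite expr0 mulr1 lerDl; lra.
apply: le_trans (uS m) _; rewrite exprS.
have : 0 <= (3 / 4 : R) ^+ m by apply: exprn_ge0; lra.
move: (u0 0%N) (u0 m) IH; move: (_ ^+ m) => q.
nra.
Qed.

(* The Hahn norm of [x] set to zero after index [n]; unlike the norm it makes
   sense for all sequences, and [hahn_head (cesaro_op t x) n] depends only on
   [x 0, ..., x n]. *)
Definition hahn_head x n : R :=
  series (hahn_term x) n + n.+1%:R * normc (x n).

Lemma hahn_series_ge0 x n : 0 <= series (hahn_term x) n.
Proof. by apply: sumr_ge0 => k _; exact: hahn_term_ge0. Qed.

Lemma hahn_series_nondecreasing x m n : (m <= n)%N ->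
  series (hahn_term x) m <= series (hahn_term x) n.
Proof. by apply: nondecreasing_series => k _ _; exact: hahn_term_ge0. Qed.

Lemma hahn_series_le_head x n : series (hahn_term x) n <= hahn_head x n.
Proof. by rewrite lerDl mulr_ge0 ?normc_ge0. Qed.

Lemma hahn_head_ge0 x n : 0 <= hahn_head x n.
Proof. exact: le_trans (hahn_series_ge0 x n) (hahn_series_le_head x n). Qed.

Lemma hahn_head_zero x : hahn_head x 0 = normc (x 0%N).
Proof. by rewrite /hahn_head /series /= big_geq// add0r mul1r. Qed.

Lemma hahn_seriesS x n :
  series (hahn_term x) n.+1 = series (hahn_term x) n + hahn_term x n.
Proof. by rewrite /series /= big_nat_recr. Qed.

(** From [n] to [n + 1], the term [(n + 1) |x_n|] is replaced by [(n + 1) |x_{n+1} - x_n| + (n + 2)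
    |x_{n+1}|], which is no smaller by the triangle inequality. *)
Lemma hahn_head_nondecreasing x m n : (m <= n)%N ->
  hahn_head x m <= hahn_head x n.
Proof.
move: m n; apply/nondecreasing_seqP => n.
rewrite /hahn_head hahn_seriesS /hahn_term -addrA lerD2l.
have := normc_subr (x n.+1) (x n.+1 - x n); rewrite subKr.
have : 1 <= n.+1%:R :> R by rewrite ler1n.
move: (normc_ge0 (x n.+1)) (normc_ge0 (x n)) (normc_ge0 (x n.+1 - x n)).
rewrite -[n.+2]addn1 natrD; move: (n.+1%:R : R) => r; nra.
Qed.

Lemma normc_le_hahn_head x k n : (k <= n)%N ->
  k.+1%:R * normc (x k) <= hahn_head x n.
Proof.
move=> /(hahn_head_nondecreasing x); apply: le_trans.
by rewrite lerDr hahn_series_ge0.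
Qed.

Lemma normc_le_hahn_head1 x k n : (k <= n)%N -> normc (x k) <= hahn_head x n.
Proof.
move=> /(normc_le_hahn_head x); apply: le_trans.
by rewrite ler_peMl ?normc_ge0// ler1n.
Qed.

(** Induction step for adding one coordinate: only [x n.+1] remains to be bounded. Its coefficient
    collects [n + 2] from the closing term and [n + 1] from the last difference. *)
Lemma hahn_headS_le x n :
  hahn_head x n.+1 <= 2 * hahn_head x n + (2 * n + 3)%:R * normc (x n.+1).
Proof.
have := normc_subr (x n.+1) (x n).
have := hahn_series_ge0 x n.
rewrite /hahn_head hahn_seriesS /hahn_term.
have : 1 <= n.+1%:R :> R by rewrite ler1n.
have -> : (2 * n + 3)%:R = 2 * n.+1%:R + 1 :> R.
  by rewrite natrD natrM -natr1; ring.
rewrite -[n.+2%:R]natr1.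
move: (normc_ge0 (x n.+1)) (normc_ge0 (x n)) (normc_ge0 (x n.+1 - x n)).
move: (n.+1%:R : R) => r; nra.
Qed.

Lemma hahn_seriesD x y n :
  series (hahn_term (x + y)) n <=
  series (hahn_term x) n + series (hahn_term y) n.
Proof.
rewrite /series /= -big_split/=; apply: ler_sum => k _; exact: hahn_termD.
Qed.

Lemma hahn_headD x y n :
  hahn_head (x + y) n <= hahn_head x n + hahn_head y n.
Proof.
rewrite /hahn_head addrACA -mulrDr lerD ?hahn_seriesD//.
by rewrite ler_wpM2l// normc_addr.
Qed.

Lemma hahn_headZ a x n : hahn_head (a *: x) n = normc a * hahn_head x n.
Proof.
rewrite /hahn_head series_hahn_termZ mulrDr; congr (_ + _).
by rewrite mulrCA -Normc.normcM.
Qed.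

Lemma hahn_head0 n : hahn_head (0 : nat -> R[i]) n = 0.
Proof.
by rewrite -(scale0r (0 : nat -> R[i])) hahn_headZ Normc.normc0 mul0r.
Qed.

Lemma hahn_headB x y n :
  hahn_head (x - y) n <= hahn_head x n + hahn_head y n.
Proof.
rewrite -scaleN1r (le_trans (hahn_headD _ _ _))// hahn_headZ.
by rewrite (normcN (1 : R[i])) Normc.normc1 mul1r.
Qed.

Lemma hahn_head_eq0 x : (forall n, hahn_head x n <= 0) -> x = 0.
Proof.
move=> x0; apply/funext => n; apply: Normc.eq0_normc; apply/eqP.
by rewrite eq_le normc_ge0 andbT (le_trans (normc_le_hahn_head1 x (leqnn n))).
Qed.

Lemma hahn_space_bounded x (M : R) :
  (forall n, hahn_head x n <= M) -> x \in @hahn_pred R.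
Proof.
move=> xM; apply/mem_set; split.
- have M0 : 0 <= M := le_trans (hahn_head_ge0 x 0) (xM 0%N).
  apply/cvgrPdist_lt => e e0.
  (* A positive element of [R[i]] is real, so the estimate takes place in [R]. *)
  have er : e = (complex.Re e)%:C%C by case: e e0 => ? ? /= /andP[/eqP-> _].
  rewrite er; have {}e0 : 0 < complex.Re e by rewrite -ltcR -er.
  near=> n; rewrite sub0r normrN.
  have -> : `|x n| = (normc (x n))%:C%C by case: (x n).
  rewrite ltcR; apply: (@le_lt_trans _ _ (M / n.+1%:R)).
    by rewrite ler_pdivlMr// mulrC (le_trans (normc_le_hahn_head x (leqnn n))).
  rewrite ltr_pdivrMr// mulrC -ltr_pdivrMr//.
  rewrite (lt_trans (_ : _ < n%:R))// ?ltr_nat//.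
  by near: n; exact: nbhs_infty_gtr.
- apply: nondecreasing_is_cvgn.
    by move=> m n; exact: hahn_series_nondecreasing.
  by exists M => _ [n _ <-]; exact: le_trans (hahn_series_le_head x n) (xM n).
Unshelve. all: by end_near. Qed.

End Estimates.

(** * Geometric convolution and the Cesàro operator in truncated norms *)

Section CesaroEstimates.
Variables (R : realType) (t : R).
Hypotheses (t_ge0 : 0 <= t) (t_lt1 : t < 1).
Implicit Types (x y : nat -> R[i]).

Local Notation normc := Normc.normc.

Definition geometric_sum x n : R[i] :=
  \sum_(i < n.+1) (t%:C)%C ^+ (n - i) * x i.

Lemma cesaro_opE x n : cesaro_op t x n = geometric_sum x n / n.+1%:R.
Proof. by []. Qed.

Lemma geometric_sum0 x : geometric_sum x 0 = x 0%N.
Proof. by rewrite /geometric_sum big_ord_recl big_ord0 addr0 mul1r. Qed.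

Lemma geometric_sumS x n :
  geometric_sum x n.+1 = (t%:C)%C * geometric_sum x n + x n.+1.
Proof.
rewrite /geometric_sum big_ord_recr/= subnn mul1r; congr (_ + _).
rewrite mulr_sumr; apply: eq_bigr => i _.
by rewrite mulrA -exprS subSn// -ltnS.
Qed.

Lemma cesaro_op0 x : cesaro_op t x 0 = x 0%N.
Proof. by rewrite cesaro_opE geometric_sum0 invr1 mulr1. Qed.

Lemma cesaro_opS x n :
  n.+2%:R * cesaro_op t x n.+1 =
  (t%:C)%C * n.+1%:R * cesaro_op t x n + x n.+1.
Proof.
rewrite !cesaro_opE geometric_sumS -(mulrA (t%:C)%C).
by rewrite ![_ * (_ / _)]mulrC !mulfVK ?pnatr_eq0.
Qed.

(** The one-step recursion characterizes the image sequence. Linearity, the eigenvectors and the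
    solution of the resolvent equation are all verified through it. *)
Lemma cesaro_op_unique x y :
  y 0%N = x 0%N ->
  (forall n, n.+2%:R * y n.+1 = (t%:C)%C * n.+1%:R * y n + x n.+1) ->
  y = cesaro_op t x.
Proof.
move=> y0 yS; apply/funext; elim=> [|n IH]; first by rewrite cesaro_op0.
apply: (@mulfI _ n.+2%:R); first by rewrite pnatr_eq0.
by rewrite yS cesaro_opS IH.
Qed.

Lemma cesaro_op_linear : linear (cesaro_op t).
Proof.
move=> a x y; symmetry; apply: cesaro_op_unique => [|n] /=.
  by rewrite !fctE !cesaro_op0.
rewrite !fctE; have := cesaro_opS x n; have := cesaro_opS y n.
move=> yS xS; rewrite /GRing.scale /=; move: yS xS.
move: (cesaro_op t x n) (cesaro_op t y n) => p q yS xS.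
rewrite mulrDr yS mulrCA xS; ring.
Qed.

Lemma cesaro_opB x y : cesaro_op t (x - y) = cesaro_op t x - cesaro_op t y.
Proof. by rewrite -scaleN1r addrC cesaro_op_linear scaleN1r addrC. Qed.

Lemma normc_t_mul a : normc ((t%:C)%C * a) = t * normc a.
Proof. by rewrite Normc.normcM normc_real ger0_norm. Qed.

Lemma normc_geometric_sumS_le x n :
  normc (geometric_sum x n.+1) <= t * normc (geometric_sum x n) + normc (x n.+1).
Proof. by rewrite geometric_sumS -normc_t_mul normc_addr. Qed.

(** With [P] the truncated norm of [x], the weighted differences of the convolution contribute
    [2 * P * ((1 - t)^-1 + 1) / (1 - t)] and the closing term half as much. *)
Definition geometric_sum_bound : R := 3 * ((1 - t)^-1 + 1) / (1 - t).

Lemma geometric_sum_bound_ge0 : 0 <= geometric_sum_bound.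
Proof.
have ? : 0 <= (1 - t)^-1 by rewrite invr_ge0 subr_ge0 ltW.
by rewrite /geometric_sum_bound !mulr_ge0 ?addr_ge0.
Qed.

(** Four affine recurrences of ratio [t], each feeding a later one: [|S_k|] gives [(k + 1) |S_k|],
    and the sum [F] of the plain differences [|S_{k+1} - S_k|] gives the sum of the weighted ones.
    The differences of [S] obey the same recursion as [S], driven by those of [x]. *)
Lemma geometric_sum_head_le x n :
  hahn_head (geometric_sum x) n <= geometric_sum_bound * hahn_head x n.
Proof.
set S := geometric_sum x; set P := hahn_head x n.
have P0 : 0 <= P by exact: hahn_head_ge0.
have t01 : 0 <= t < 1 by rewrite t_ge0.
have c1 : 1 <= (1 - t)^-1 by rewrite invf_ge1 ?subr_gt0// gerBl.
have c0 : 0 <= (1 - t)^-1 by lra.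
have le_div (r : R) : 0 <= r -> r <= r / (1 - t) by move=> r0; rewrite ler_peMr.
have x0P : normc (x 0%N) <= P by exact: normc_le_hahn_head1.
have S0 : S 0%N = x 0%N by exact: geometric_sum0.
pose Q := P / (1 - t).
have PQ : P <= Q by exact: le_div.
have SQ k : (k <= n)%N -> normc (S k) <= Q.
  move: k; apply: affine_recurrence_le => // [|k kn].
    by rewrite S0 (le_trans x0P).
  apply: le_trans (normc_geometric_sumS_le x k) _.
  by rewrite lerD2l normc_le_hahn_head1.
have kSQ : n.+1%:R * normc (S n) <= (Q + P) / (1 - t).
  apply: (@affine_recurrence_le R t (Q + P) (fun k => k.+1%:R * normc (S k)) n
    t01 _ _ n (leqnn n)) => [|k kn].
    by rewrite mul1r S0 (le_trans _ (le_div _ _)); lra.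
  have := normc_geometric_sumS_le x k; rewrite -/S => Sk.
  have := SQ k (ltnW kn); have := normc_le_hahn_head x kn; rewrite -/P.
  have := normc_ge0 (S k); rewrite -natr1 mulrDl mul1r.
  have : 1 <= k.+1%:R :> R by rewrite ler1n.
  move: Sk; rewrite -natr1; move: (k.+1%:R : R) => r; nra.
have eS k : normc (S k.+2 - S k.+1) <=
    t * normc (S k.+1 - S k) + normc (x k.+2 - x k.+1).
  rewrite -normc_t_mul (le_trans _ (normc_addr _ _))//.
  rewrite le_eqVlt; apply/orP; left; apply/eqP; congr normc.
  rewrite /S !geometric_sumS; ring.
have e0 : normc (S 1%N - S 0%N) <= normc (x 0%N) + normc (x 1%N - x 0%N).
  rewrite /S geometric_sumS geometric_sum0 -addrA.
  apply: le_trans (normc_addr _ _) _; rewrite lerD2r normc_t_mul.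
  by rewrite ler_piMl ?normc_ge0// ltW.
pose F k := \sum_(0 <= j < k) normc (S j.+1 - S j).
have FS k : F k.+1 = F k + normc (S k.+1 - S k) by rewrite /F big_nat_recr.
have serP k : (k <= n)%N -> normc (x 0%N) + series (hahn_term x) k <= 2 * P.
  move=> kn; rewrite mulr_natl mulr2n lerD//.
  by rewrite (le_trans (hahn_series_nondecreasing x kn))// hahn_series_le_head.
have F_rec k : F k.+1 <= t * F k + (normc (x 0%N) + series (hahn_term x) k.+1).
  elim: k => [|k IH].
    rewrite FS /F /series /= !big_nat1 !big_geq// mulr0 !add0r.
    by rewrite /hahn_term mul1r.
  rewrite FS hahn_seriesS.
  have -> : t * F k.+1 = t * F k + t * normc (S k.+1 - S k).
    by rewrite FS mulrDr.
  have := eS k; have : normc (x k.+2 - x k.+1) <= hahn_term x k.+1.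
    by rewrite /hahn_term ler_peMl ?normc_ge0// ler1n.
  lra.
have F_le k : (k <= n)%N -> F k <= 2 * P / (1 - t).
  move: k; apply: affine_recurrence_le => // [|k kn].
    by rewrite /F big_geq// !mulr_ge0.
  by rewrite (le_trans (F_rec k))// lerD2l serP.
(* Splitting the weight [k + 2] as [(k + 1) + 1] separates a multiple of the weighted sum from the
   extra term [t * F k]. *)
have E_rec k : series (hahn_term S) k.+1 <= t * series (hahn_term S) k +
    (t * F k + (normc (x 0%N) + series (hahn_term x) k.+1)).
  elim: k => [|k IH].
    rewrite /F /series /= !big_nat1 !big_geq// !mulr0 !add0r.
    by rewrite /hahn_term !mul1r.
  rewrite hahn_seriesS (hahn_seriesS x k.+1).
  have -> : t * series (hahn_term S) k.+1 =
      t * series (hahn_term S) k + t * (k.+1%:R * normc (S k.+1 - S k)).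
    by rewrite hahn_seriesS mulrDr.
  have -> : t * F k.+1 = t * F k + t * normc (S k.+1 - S k).
    by rewrite FS mulrDr.
  have : hahn_term S k.+1 <=
      t * (k.+1%:R * normc (S k.+1 - S k)) + t * normc (S k.+1 - S k)
      + hahn_term x k.+1.
    rewrite -mulrDr -{2}[normc (S k.+1 - S k)]mul1r -mulrDl natr1 mulrCA.
    by rewrite -mulrDr ler_wpM2l.
  lra.
have E_le : series (hahn_term S) n <= (2 * P / (1 - t) + 2 * P) / (1 - t).
  apply: (@affine_recurrence_le R t (2 * P / (1 - t) + 2 * P)
    (series (hahn_term S)) n t01 _ _ n (leqnn n)) => [|k kn].
    have PP0 : 0 <= 2 * P / (1 - t) by rewrite !mulr_ge0.
    by rewrite /series /= big_geq// mulr_ge0// addr_ge0// mulr_ge0.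
  rewrite (le_trans (E_rec k))// lerD2l lerD ?serP//.
  have := F_le k (ltnW kn); apply: le_trans.
  rewrite ler_piMl//; last exact: ltW.
  apply: sumr_ge0 => j _; exact: normc_ge0.
apply: le_trans (lerD E_le kSQ) _.
rewrite le_eqVlt; apply/orP; left; apply/eqP.
rewrite /geometric_sum_bound /Q; field; lra.
Qed.

(** One [geometric_sum_bound] pays for the differences of the convolution beyond [N], the other for
    its size there together with the closing term. *)
Definition cesaro_bound : R := 2 * geometric_sum_bound.

Lemma cesaro_bound_ge0 : 0 <= cesaro_bound.
Proof. by rewrite mulr_ge0 ?geometric_sum_bound_ge0. Qed.

Lemma hahn_term_div x k :
  hahn_term (fun j => x j / j.+1%:R) k <=
  (hahn_term x k + normc (x k)) / k.+2%:R.
Proof.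
rewrite /hahn_term ler_pdivlMr// -(@normc_nat R k.+1) -(@normc_nat R k.+2).
rewrite -!Normc.normcM.
have -> : k.+1%:R * (x k.+1 / k.+2%:R - x k / k.+1%:R) * k.+2%:R =
          k.+1%:R * (x k.+1 - x k) - x k.
  have := pnatr_eq0 R[i] k.+1; have := pnatr_eq0 R[i] k.+2.
  rewrite -(natr1 k.+1); move: (k.+1%:R : R[i]) => r /= ? ?.
  by field; apply/andP; split; apply/negPf.
exact: normc_subr.
Qed.

(** Beyond [N], the differences gain the factor [1 / (N + 1)], while [|x_k| / (k + 2)] is at most
    the truncated norm times [1 / ((k + 1) (k + 2))], which telescopes. *)
Lemma hahn_series_div_tail x N n : (N <= n)%N ->
  series (hahn_term (fun j => x j / j.+1%:R)) n <=
  series (hahn_term (fun j => x j / j.+1%:R)) N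
  + (series (hahn_term x) n - series (hahn_term x) N) / N.+1%:R
  + hahn_head x n * (N.+1%:R^-1 - n.+1%:R^-1).
Proof.
move=> Nn; set y := fun j => _.
(* The bound [Q] is fixed before the induction, since [hahn_head x n] itself changes with [n]. *)
suff : forall Q, (forall k, (k <= n)%N -> k.+1%:R * normc (x k) <= Q) ->
   series (hahn_term y) n <= series (hahn_term y) N +
   (series (hahn_term x) n - series (hahn_term x) N) / N.+1%:R +
   Q * (N.+1%:R^-1 - n.+1%:R^-1).
  by apply=> k; exact: normc_le_hahn_head.
move=> Q; elim: n Nn => [|n IH].
  by rewrite leqn0 => /eqP-> _; rewrite !subrr mul0r mulr0 !addr0.
rewrite leq_eqVlt => /orP[/eqP<- _|].
  by rewrite !subrr mul0r mulr0 !addr0.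
rewrite ltnS => Nn xQ; rewrite (hahn_seriesS y) (hahn_seriesS x).
have {}IH := IH Nn (fun k kn => xQ k (leqW kn)).
have := hahn_term_div x n; rewrite -/y mulrDl.
have h1 : hahn_term x n / n.+2%:R <= hahn_term x n / N.+1%:R.
  by rewrite ler_wpM2l ?hahn_term_ge0// lef_pV2 ?posrE// ler_nat ltnS leqW.
have h2 : normc (x n) / n.+2%:R <= Q * (n.+1%:R^-1 - n.+2%:R^-1).
  have -> : n.+1%:R^-1 - n.+2%:R^-1 = n.+1%:R^-1 / n.+2%:R :> R.
    rewrite -(natr1 n.+1).
    have : 0 < n.+1%:R :> R by []. move: (n.+1%:R : R) => r r0; field; lra.
  rewrite mulrA ler_wpM2r// ler_pdivlMr// mulrC; exact: xQ.
move: IH h1 h2; move: (N.+1%:R^-1 : R) (n.+1%:R^-1 : R) (n.+2%:R^-1 : R).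
move=> a b c; lra.
Qed.

(** The closing term of [C_t x] is [|S_n|], hence at most [Q / (n + 1)] with [Q] the truncated norm
    of the convolution [S]; this cancels the negative end of the telescoped sum and leaves
    [2 * Q / (N + 1)]. *)
Lemma cesaro_head_tail x N n : (N <= n)%N ->
  hahn_head (cesaro_op t x) n <=
  series (hahn_term (cesaro_op t x)) N +
  cesaro_bound / N.+1%:R * hahn_head x n.
Proof.
move=> Nn; rewrite /hahn_head.
have := hahn_series_div_tail (geometric_sum x) Nn.
have := geometric_sum_head_le x n.
have := hahn_series_le_head (geometric_sum x) n.
have := hahn_series_ge0 (geometric_sum x) N.
have := normc_le_hahn_head (geometric_sum x) (leqnn n).
have := hahn_head_ge0 (geometric_sum x) n.
rewrite -/(hahn_head x n).
have -> : n.+1%:R * normc (cesaro_op t x n) = normc (geometric_sum x n).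
  rewrite cesaro_opE Normc.normcM Normc.normcV normc_nat mulrC mulfVK//.
set S := geometric_sum x; set Q := hahn_head S n.
move=> Q0; rewrite mulrC -ler_pdivlMr// => SQ s0 sQ QK.
move=> /(lerD)/(_ SQ) /le_trans; apply.
rewrite -addrA -addrA lerD2l /cesaro_bound.
have i0 : 0 <= N.+1%:R^-1 :> R by [].
move: (series _ n) (series _ N) s0 sQ => sn sN s0 sQ.
move: (N.+1%:R^-1 : R) i0 => r r0; move: (n.+1%:R^-1 : R) => r'.
rewrite mulrBr subrK.
have : r * Q <= r * (geometric_sum_bound * hahn_head x n) by rewrite ler_wpM2l.
have : (sn - sN) * r <= Q * r by rewrite ler_wpM2r//; lra.
rewrite -/S in sQ *; lra.
Qed.

Lemma cesaro_head_le x n :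
  hahn_head (cesaro_op t x) n <= (1 + cesaro_bound) * hahn_head x n.
Proof.
have := @cesaro_head_tail x 0 n (leq0n n).
rewrite {1}/series /= big_geq// invr1 mulr1 add0r => /le_trans; apply.
by rewrite mulrDl mul1r lerDr hahn_head_ge0.
Qed.

End CesaroEstimates.

(** * Resolvent equation, eigenvectors and decay of the iterates *)

Section CesaroSpectralEstimates.
Variables (R : realType) (t : R).
Hypotheses (t_ge0 : 0 <= t) (t_lt1 : t < 1).
Implicit Types (x y : nat -> R[i]) (l : R[i]).

Local Notation normc := Normc.normc.
Local Notation T := (cesaro_op t).

Lemma cesaro_head_approx (e : R) : 0 < e ->
  exists N, forall x n, hahn_head (T x) n <= hahn_head (T x) N + e * hahn_head x n.
Proof.
move=> e0; have [N LN] := exists_divn_le (cesaro_bound t) e0.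
exists N => x n; have [Nn|nN] := leqP N n.
  apply: le_trans (cesaro_head_tail t_ge0 t_lt1 x Nn) _.
  by rewrite lerD ?hahn_series_le_head// ler_wpM2r ?hahn_head_ge0.
apply: le_trans (hahn_head_nondecreasing (T x) (ltnW nN)) _.
by rewrite lerDl mulr_ge0 ?hahn_head_ge0 ?ltW.
Qed.

(** With tolerance [|l| / 2] in the tail estimate, half of [|l| * hahn_head x n] is absorbed on the
    left. Neither [N] nor [C] depends on [n]. *)
Lemma resolvent_equation_apriori l : l != 0 ->
  exists N, exists2 C : R, 0 <= C & forall x n,
    hahn_head x n <= C * (hahn_head (l *: x - T x) n + hahn_head x N).
Proof.
move=> l0; have nl : 0 < normc l.
  rewrite lt_neqAle normc_ge0 andbT eq_sym.
  by apply: contra l0 => /eqP/Normc.eq0_normc ->.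
have [|N TN] := @cesaro_head_approx (normc l / 2); first by rewrite divr_gt0.
have L0 := cesaro_bound_ge0 t_lt1.
exists N, (2 / normc l * (1 + cesaro_bound t)).
  by rewrite !mulr_ge0 ?addr_ge0// invr_ge0 ltW.
move=> x n; rewrite -(ler_pM2l nl).
have -> (L q : R) : normc l * (2 / normc l * L * q) = 2 * L * q.
  by field; rewrite gt_eqF.
have : normc l * hahn_head x n <=
       hahn_head (l *: x - T x) n + hahn_head (T x) n.
  by rewrite -hahn_headZ -{1}(subrK (T x) (l *: x)) hahn_headD.
have := TN x n; have := cesaro_head_le t_ge0 t_lt1 x N.
have := mulr_ge0 L0 (hahn_head_ge0 (l *: x - T x) n).
nra.
Qed.

Lemma normc_ratio_mul_le n (a : R[i]) :
  normc ((t%:C)%C * (n.+1%:R / n.+2%:R * a)) <= normc a.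
Proof.
rewrite normc_t_mul// Normc.normcM mulrA ler_piMl ?normc_ge0//.
rewrite mulr_ile1 ?normc_ge0//; first exact: ltW.
by rewrite Normc.normcM Normc.normcV !normc_nat ler_pdivrMr// mul1r ler_nat.
Qed.

(** Forward substitution in a lower triangular system whose diagonal entries [l - 1 / (n + 1)] do
    not vanish; the constant may grow with [N]. *)
Lemma resolvent_equation_head l N : ~ Lambda l ->
  exists2 C : R, 0 <= C & forall x,
    hahn_head x N <= C * hahn_head (l *: x - T x) N.
Proof.
move=> lL.
have dl n : 0 < normc (l - n.+1%:R^-1).
  rewrite lt_neqAle normc_ge0 andbT eq_sym; apply/negP => /eqP/Normc.eq0_normc.
  by move/subr0_eq => ln; apply: lL; exists n.
elim: N => [|N [C C0 IH]].
  exists (normc (l - 1))^-1; first by rewrite invr_ge0 normc_ge0.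
  have := dl 0%N; rewrite invr1 => d0 x.
  rewrite ler_pdivlMl// !hahn_head_zero -Normc.normcM.
  rewrite (_ : (_ - _) 0%N = (l - 1) * x 0%N)//.
  by rewrite mulrBl mul1r -{2}(cesaro_op0 t x).
pose D := (normc (l - N.+2%:R^-1))^-1 * (2 + normc l * C).
have D0 : 0 <= D.
  by rewrite mulr_ge0 ?invr_ge0 ?normc_ge0// addr_ge0 ?mulr_ge0 ?normc_ge0.
exists (2 * C + (2 * N + 3)%:R * D) => [|x].
  by rewrite addr_ge0// mulr_ge0.
set y := l *: x - T x; set Y := hahn_head y N.+1.
have yY : hahn_head y N <= Y by exact: hahn_head_nondecreasing.
have xY : hahn_head x N <= C * Y.
  by rewrite (le_trans (IH x))// ler_wpM2l.
suff x1 : normc (x N.+1) <= D * Y.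
  apply: le_trans (hahn_headS_le x N) _.
  by rewrite [leRHS]mulrDl; apply: lerD; rewrite -mulrA ler_wpM2l.
rewrite /D -mulrA ler_pdivlMl// -Normc.normcM.
(* Row [N.+1] of the system, with [T x N] eliminated as [l * x N - y N], so that only the preceding
   coordinate of [x] occurs. *)
have -> : (l - N.+2%:R^-1) * x N.+1 =
    y N.+1 + (t%:C)%C * (N.+1%:R / N.+2%:R * (l * x N - y N)).
  have -> : y N.+1 = l * x N.+1 - T x N.+1 by [].
  have -> : l * x N - y N = T x N.
    by rewrite (_ : y N = l * x N - T x N)// subKr.
  apply: (@mulfI _ N.+2%:R); first by rewrite pnatr_eq0.
  have := cesaro_opS t x N; have : N.+2%:R != 0 :> R[i] by rewrite pnatr_eq0.
  move: (N.+1%:R : R[i]) (N.+2%:R : R[i]) => r s s0.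
  move: (T x N.+1) (T x N) => a b ab; rewrite mulrDr mulrBr ab.
  by field.
apply: le_trans (normc_addr _ _) _.
have := normc_ratio_mul_le N (l * x N - y N).
have := normc_subr (l * x N) (y N); rewrite Normc.normcM.
have := normc_le_hahn_head1 y (leqnn N.+1).
have := normc_le_hahn_head1 y (leqnSn N); rewrite -/Y.
have : normc l * normc (x N) <= normc l * (C * Y).
  by rewrite ler_wpM2l ?normc_ge0// (le_trans _ xY)// normc_le_hahn_head1.
rewrite mulrDl -mulrA; lra.
Qed.

(** The a priori estimate fixes one [N], and forward substitution is applied at that [N] only; hence
    the constant is uniform in [n]. *)
Lemma resolvent_equation_bound l : ~ Lambda0 l ->
  exists2 C : R, 0 <= C & forall x (M : R),
    (forall n, hahn_head (l *: x - T x) n <= M) ->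
    forall n, hahn_head x n <= C * M.
Proof.
move=> lL; have l0 : l != 0 by apply/eqP => l0; apply: lL; right.
have {}lL : ~ Lambda l by move=> ?; apply: lL; left.
have [N [C C0 xC]] := resolvent_equation_apriori l0.
have [D D0 xD] := resolvent_equation_head N lL.
exists (C * (1 + D)) => [|x M yM n]; first by rewrite mulr_ge0 ?addr_ge0.
rewrite (le_trans (xC x n))// -mulrA ler_wpM2l// mulrDl mul1r lerD//.
by rewrite (le_trans (xD x))// ler_wpM2l.
Qed.

(** With zero right-hand side, the a priori estimate bounds every truncated norm by the one at [N].
    So formal eigenvectors lie in the Hahn space without any estimate of binomial coefficients. *)
Lemma eigenvector_hahn l x : l != 0 -> T x = l *: x -> x \in @hahn_pred R.
Proof.
move=> l0 Tx; have [N [C C0 xC]] := resolvent_equation_apriori l0.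
apply: (@hahn_space_bounded _ _ (C * hahn_head x N)) => n.
rewrite (le_trans (xC x n))// Tx subrr ler_wpM2l// gerDr.
by rewrite hahn_head0.
Qed.

Definition cesaro_eigenvector m n : R[i] :=
  'C(n, m)%:R * (t%:C)%C ^+ (n - m).

(** The recursion reduces to the identity [(n + 1) C(n, m) = (n + 1 - m) C(n + 1, m)]. *)
Lemma cesaro_eigenvectorE m :
  T (cesaro_eigenvector m) = m.+1%:R^-1 *: cesaro_eigenvector m.
Proof.
symmetry; apply: cesaro_op_unique => [|n].
  rewrite /cesaro_eigenvector; case: m => [|m]; first by rewrite invr1 scale1r.
  by rewrite fctE bin0n mul0r scaler0.
have scE (a b : R[i]) : a *: b = a * b by [].
rewrite !fctE !scE.
suff E : n.+2%:R * cesaro_eigenvector m n.+1 =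
    (t%:C)%C * n.+1%:R * cesaro_eigenvector m n
    + m.+1%:R * cesaro_eigenvector m n.+1.
  by rewrite mulrCA E mulrDr mulKf ?pnatr_eq0// mulrCA.
rewrite /cesaro_eigenvector.
(* Below the diagonal index everything vanishes, except for [n + 1 = m], where the factors [n + 2]
   and [m + 1] agree. *)
have [nm|mn] := ltnP n m.
  rewrite (bin_small nm) mul0r mulr0 add0r.
  have [nm1|] := ltnP n.+1 m; first by rewrite bin_small// mul0r !mulr0.
  by rewrite leq_eqVlt ltnNge nm orbF => /eqP->.
have : (n.+1 * 'C(n, m))%:R = ((n.+1 - m) * 'C(n.+1, m))%:R :> R[i].
  by rewrite -mul_bin_down.
rewrite !natrM natrB ?(leqW mn)// subSn// exprS.
rewrite -(natr1 n.+1) -(natr1 m).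
move: (n.+1%:R : R[i]) (m%:R : R[i]) ('C(n, m)%:R : R[i]) ('C(n.+1, m)%:R : R[i]).
move: (t%:C)%C => u a b c d acd.
transitivity (u * u ^+ (n - m) * ((a - b) * d) + (b + 1) * (d * (u * u ^+ (n - m)))).
  ring.
rewrite -acd; ring.
Qed.

Lemma iter_cesaro_op0 x m : iter m T x 0%N = x 0%N.
Proof. by elim: m => //= m IH; rewrite cesaro_op0. Qed.

(** The condition [x 0 = 0] removes the diagonal entry 1, and the others are at most 1/2. By
    induction on [N], the new coordinate is halved at each step up to a forcing of order
    [(3 / 4) ^+ m] from the earlier ones. *)
Lemma iter_cesaro_head N : exists2 C : R, 0 <= C & forall x, x 0%N = 0 ->
  forall m, hahn_head (iter m T x) N <= C * (3 / 4) ^+ m * hahn_head x N.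
Proof.
elim: N => [|N [C C0 IH]].
  exists 0 => // x x0 m.
  by rewrite hahn_head_zero iter_cesaro_op0 x0 Normc.normc0 !mul0r.
pose D := 1 + 4 * C; have D0 : 0 <= D by rewrite /D; lra.
exists (2 * C + (2 * N + 3)%:R * D) => [|x x0 m].
  by rewrite addr_ge0// mulr_ge0.
set X := hahn_head x N.+1; have X0 : 0 <= X by exact: hahn_head_ge0.
have xX : hahn_head x N <= X by exact: hahn_head_nondecreasing.
have q0 k : 0 <= (3 / 4 : R) ^+ k by apply: exprn_ge0; lra.
have {}IH k : hahn_head (iter k T x) N <= C * (3 / 4) ^+ k * X.
  by apply: le_trans (IH x x0 k) _; rewrite ler_wpM2l// mulr_ge0.
pose u k := normc (iter k T x N.+1).
have u_le : u m <= D * (3 / 4) ^+ m * X.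
  have CX0 : 0 <= C * X by rewrite mulr_ge0.
  apply: (@le_trans _ _ ((u 0%N + 4 * (C * X)) * (3 / 4) ^+ m)); last first.
    rewrite mulrAC ler_wpM2r//.
    have -> : D * X = X + 4 * (C * X) by rewrite /D; ring.
    rewrite lerD2r; exact: normc_le_hahn_head1.
  apply: geometric_recurrence_le => // k; first exact: normc_ge0.
  (* The recursion couples coordinate [N.+1] of iterate [k.+1] to coordinate [N] of the same
     iterate; the spare factor 3/4 in its bound is dropped. *)
  have : normc (iter k.+1 T x N) <= C * X * (3 / 4) ^+ k.
    rewrite mulrAC.
    apply: le_trans (normc_le_hahn_head1 _ (leqnn N)) (le_trans (IH k.+1) _).
    rewrite ler_wpM2r// ler_wpM2l// exprS ler_piMl//; lra.
  rewrite /u; set z := iter k T x => zN.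
  have -> : iter k.+1 T x N.+1 =
      (t%:C)%C * (N.+1%:R / N.+2%:R * iter k.+1 T x N) + N.+2%:R^-1 * z N.+1.
    apply: (@mulfI _ N.+2%:R); first by rewrite pnatr_eq0.
    rewrite iterS cesaro_opS -/z.
    have : N.+2%:R != 0 :> R[i] by rewrite pnatr_eq0.
    move: (N.+1%:R : R[i]) (N.+2%:R : R[i]) => r s s0.
    by move: (T z N) (z _) => a b; field.
  apply: le_trans (normc_addr _ _) _; rewrite addrC; apply: lerD.
    rewrite Normc.normcM ler_wpM2r ?normc_ge0// Normc.normcV normc_nat.
    by rewrite lef_pV2 ?posrE// ler_nat.
  exact: le_trans (normc_ratio_mul_le _ _) zN.
apply: le_trans (hahn_headS_le _ N) _.
by rewrite -mulrA [leRHS]mulrDl; apply: lerD; rewrite -mulrA ler_wpM2l// mulrA.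
Qed.

(** The tail estimate with tolerance 1/2 gives the same recurrence for the whole truncated norm, now
    forced by the coordinates up to a fixed [N]. *)
Lemma iter_cesaro_bound : exists2 C : R, 0 <= C & forall x (M : R),
  x 0%N = 0 -> (forall n, hahn_head x n <= M) ->
  forall m n, hahn_head (iter m T x) n <= C * (3 / 4) ^+ m * M.
Proof.
have [|N TN] := @cesaro_head_approx 2^-1; first by rewrite invr_gt0.
have [C C0 xC] := iter_cesaro_head N.
exists (1 + 4 * C) => [|x M x0 xM m n]; first by rewrite addr_ge0// mulr_ge0.
have q0 k : 0 <= (3 / 4 : R) ^+ k by apply: exprn_ge0; lra.
have M0 : 0 <= M := le_trans (hahn_head_ge0 x 0) (xM 0%N).
have CM0 : 0 <= C * M by rewrite mulr_ge0.
pose u k := hahn_head (iter k T x) n.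
apply: (@le_trans _ _ ((u 0%N + 4 * (C * M)) * (3 / 4) ^+ m)); last first.
  rewrite mulrAC ler_wpM2r//.
  have -> : (1 + 4 * C) * M = M + 4 * (C * M) by ring.
  by rewrite lerD2r; exact: xM.
apply: (@geometric_recurrence_le _ _ u) => // k; first exact: hahn_head_ge0.
rewrite addrC; apply: le_trans (TN _ n) _; rewrite lerD2r.
apply: le_trans (xC x x0 k.+1) _.
apply: (@le_trans _ _ (C * (3 / 4) ^+ k.+1 * M)).
  by rewrite ler_wpM2l// mulr_ge0.
by rewrite mulrAC ler_wpM2l// exprS ler_piMl//; lra.
Qed.

End CesaroSpectralEstimates.

(** * The real-valued norm and the operator norm *)

Section NormLemmas.
Variables (R : realType) (V : normedModType R[i]).
Implicit Types (x y : V) (T : V -> V).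

Local Notation normc := Normc.normc.

Lemma rnormE x : `|x| = ((rnorm x)%:C)%C.
Proof. by rewrite /rnorm; case: `|x| (normr_ge0 x) => a b /= /andP[/eqP-> _]. Qed.

Lemma rnorm_ge0 x : 0 <= rnorm x.
Proof. by rewrite -lecR -rnormE normr_ge0. Qed.

Lemma rnorm0 : rnorm (0 : V) = 0.
Proof. by rewrite /rnorm normr0. Qed.

Lemma rnorm_gt0 x : x != 0 -> 0 < rnorm x.
Proof. by move=> x0; rewrite -ltcR -rnormE normr_gt0. Qed.

Lemma rnormD x y : rnorm (x + y) <= rnorm x + rnorm y.
Proof. by rewrite -lecR rmorphD/= -!rnormE ler_normD. Qed.

Lemma rnormN x : rnorm (- x) = rnorm x.
Proof. by rewrite /rnorm normrN. Qed.

Lemma rnormB x y : rnorm (x - y) <= rnorm x + rnorm y.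
Proof. by rewrite -(rnormN y) rnormD. Qed.

Lemma rnormZ (l : R[i]) x : rnorm (l *: x) = normc l * rnorm x.
Proof.
apply/(@complexI R); rewrite -rnormE normrZ rmorphM/= -rnormE.
by congr (_ * _); case: l.
Qed.

Lemma rnorm_sum (I : Type) (r : seq I) (P : pred I) (F : I -> V) :
  rnorm (\sum_(i <- r | P i) F i) <= \sum_(i <- r | P i) rnorm (F i).
Proof.
elim/big_ind2: _ => [|a b c d ab cd|//]; first by rewrite rnorm0.
by rewrite (le_trans (rnormD _ _))// lerD.
Qed.

Lemma opnorm_le T (M : R) : 0 <= M -> (forall x, rnorm (T x) <= M * rnorm x) ->
  (opnorm T <= M%:E)%E.
Proof.
move=> M0 TM; apply: ge_ereal_sup => _ [x /= x1 <-].
by rewrite lee_fin (le_trans (TM x))// ler_piMr.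
Qed.

Lemma opnorm_ge0 T : (0 <= opnorm T)%E.
Proof.
apply: (@le_trans _ _ (rnorm (T 0))%:E); first by rewrite lee_fin rnorm_ge0.
by apply: ereal_sup_ubound; exists 0 => //=; rewrite rnorm0.
Qed.

End NormLemmas.

(** * Limits of bounded scalar functions along an ultrafilter *)

Section UltrafilterLimits.
Variables (R : realType) (X : Type) (F : set_system X).
Hypothesis FU : UltraFilter F.

Local Notation normc := Normc.normc.

(** Compactness of [[-M, M]] gives a cluster point of the image filter, and an ultrafilter converges
    to its cluster points. *)
Lemma ultrafilter_real_limit (f : X -> R) (M : R) :
  F [set x | `|f x| <= M] ->
  exists a, forall e, 0 < e -> F [set x | `|f x - a| < e].
Proof.
move=> fM; have [a [_ fa]] : (`[- M, M]%classic `&` cluster (f @ F)) !=set0.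
  apply: segment_compact.
  rewrite /fmap /=; apply: filterS fM => x /=.
  by rewrite in_itv/= ler_norml.
exists a => e e0; have [//|] := in_ultra_setVsetC [set x | `|f x - a| < e] FU.
move=> /(fa [set r | ~ `|r - a| < e])/(_ (nbhsx_ballx a e e0)) [r [/= ra]].
by rewrite /ball/= distrC.
Qed.

Lemma ultrafilter_complex_limit (f : X -> R[i]) (M : R) :
  F [set x | normc (f x) <= M] ->
  exists a, forall e, 0 < e -> F [set x | normc (f x - a) < e].
Proof.
move=> fM.
have normc_ReIm (z : R[i]) : normc z <= `|complex.Re z| + `|complex.Im z|.
  case: z => a b /=; rewrite -(ler_pXn2r (n := 2))// ?nnegrE ?sqrtr_ge0 ?addr_ge0//.
  rewrite sqr_sqrtr ?addr_ge0 ?sqr_ge0// sqrrD !real_normK ?num_real//.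
  by rewrite addrAC lerDl mulrn_wge0// mulr_ge0.
have Re_le (z : R[i]) : `|complex.Re z| <= normc z.
  case: z => a b /=; rewrite -sqrtr_sqr ler_sqrt ?addr_ge0 ?sqr_ge0//.
  by rewrite lerDl sqr_ge0.
have Im_le (z : R[i]) : `|complex.Im z| <= normc z.
  case: z => a b /=; rewrite -sqrtr_sqr ler_sqrt ?addr_ge0 ?sqr_ge0//.
  by rewrite lerDr sqr_ge0.
have [|a fa] := @ultrafilter_real_limit (fun x => complex.Re (f x)) M.
  by apply: filterS fM => x /=; exact: le_trans.
have [|b fb] := @ultrafilter_real_limit (fun x => complex.Im (f x)) M.
  by apply: filterS fM => x /=; exact: le_trans.
exists (a +i* b)%C => e e0; have e2 : 0 < e / 2 by rewrite divr_gt0.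
apply: filterS2 (fa _ e2) (fb _ e2) => x /= xa xb.
apply: le_lt_trans (normc_ReIm _) _; rewrite (splitr e) ltrD//.
  by move: xa; case: (f x).
by move: xb; case: (f x).
Qed.

End UltrafilterLimits.

(** * The Hahn norm as the supremum of the truncated norms *)

Section HahnNorm.
Variable R : realType.
Implicit Types x y : hahn R.

Local Notation normc := Normc.normc.

Lemma rnorm_hahnE x : rnorm x = limn (series (hahn_term x)).
Proof. by []. Qed.

Lemma rnorm_hahn_le x (M : R) :
  (forall n, series (hahn_term x) n <= M) -> rnorm x <= M.
Proof.
move=> xM; rewrite rnorm_hahnE; apply: limr_le; first exact: hahn_is_cvg.
by near=> n; exact: xM.
Unshelve. all: by end_near. Qed.

Lemma hahn_series_le_rnorm x n : series (hahn_term x) n <= rnorm x.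
Proof.
apply: nondecreasing_cvgn_le; last exact: hahn_is_cvg.
by move=> k m; exact: hahn_series_nondecreasing.
Qed.

(** The value [x n] is compared with [x m] through the differences at indices [k >= n], whose
    weights are at least [n + 1]. *)
Lemma hahn_head_le_series (x : nat -> R[i]) n m : (n <= m)%N ->
  hahn_head x n <= series (hahn_term x) m + n.+1%:R * normc (x m).
Proof.
elim: m => [|m IH]; first by rewrite leqn0 => /eqP->.
rewrite leq_eqVlt => /orP[/eqP->//|]; rewrite ltnS => nm.
apply: le_trans (IH nm) _; rewrite hahn_seriesS -addrA lerD2l /hahn_term.
have := normc_subr (x m.+1) (x m.+1 - x m); rewrite subKr => xm.
apply: (@le_trans _ _ (n.+1%:R * (normc (x m.+1) + normc (x m.+1 - x m)))).
  by rewrite ler_wpM2l.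
rewrite [leLHS]mulrDr [leRHS]addrC lerD2l.
by rewrite ler_wpM2r ?normc_ge0// ler_nat ltnS.
Qed.

(** As [m] grows in the previous estimate, [(n + 1) |x_m|] tends to 0 because [x] is a null
    sequence. *)
Lemma hahn_head_le_rnorm x n : hahn_head x n <= rnorm x.
Proof.
apply/ler_addgt0Pl => e e0.
have d0 : 0 < e / n.+1%:R by rewrite divr_gt0.
have /cvgrPdist_lt/(_ (((e / n.+1%:R)%:C)%C)) := @hahn_cvg0 R x.
rewrite ltcR => /(_ d0) xe.
near \oo => m.
have : normc (x m) < e / n.+1%:R.
  have : (`|0 - x m : R[i]^o| < ((e / n.+1%:R)%:C)%C) by near: m.
  rewrite sub0r normrN.
  by have -> : `|x m| = ((normc (x m))%:C)%C by [case: (x m)]; rewrite ltcR.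
rewrite ltr_pdivlMr// mulrC => /ltW xm.
have nm : (n <= m)%N by near: m; exact: nbhs_infty_ge.
apply: le_trans (hahn_head_le_series x nm) _.
by rewrite addrC lerD// hahn_series_le_rnorm.
Unshelve. all: by end_near. Qed.

Lemma normc_le_rnorm x n : normc (x n) <= rnorm x.
Proof.
exact: le_trans (normc_le_hahn_head1 x (leqnn n)) (hahn_head_le_rnorm x n).
Qed.

Lemma rnorm_hahn_head_le x (M : R) :
  (forall n, hahn_head x n <= M) -> rnorm x <= M.
Proof.
move=> xM; apply: rnorm_hahn_le => n; apply: le_trans (xM n).
exact: hahn_series_le_head.
Qed.

End HahnNorm.

(** * Compactness of bounded sets with uniformly small tails *)

Section HahnCompactness.
Variable R : realType.

Local Notation normc := Normc.normc.

Definition hahn_uniform_tail (M : R) : set (hahn R) :=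
  [set y | (forall n, hahn_head y n <= M) /\
    forall N n, (N <= n)%N ->
      series (hahn_term y) n <= series (hahn_term y) N + M / N.+1%:R].

Lemma hahn_headBC (x y : nat -> R[i]) n : hahn_head (x - y) n = hahn_head (y - x) n.
Proof.
by rewrite -opprB -scaleN1r hahn_headZ (normcN (1 : R[i])) Normc.normc1 mul1r.
Qed.

Lemma hahn_seriesB (x y : nat -> R[i]) n :
  series (hahn_term x) n - series (hahn_term y) n <= hahn_head (x - y) n.
Proof.
rewrite lerBlDr; have := hahn_seriesD (x - y) y n; rewrite subrK => /le_trans.
by apply; rewrite lerD2r hahn_series_le_head.
Qed.

Lemma hahn_tailB (x y : nat -> R[i]) N n : (N <= n)%N ->
  series (hahn_term (x - y)) n - series (hahn_term (x - y)) N <=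
  (series (hahn_term x) n - series (hahn_term x) N) +
  (series (hahn_term y) n - series (hahn_term y) N).
Proof.
move=> Nn; rewrite !sub_series_geq// -big_split/=; apply: ler_sum => k _.
have := hahn_termD x (-1 *: y) k.
by rewrite hahn_termZ scaleN1r (normcN (1 : R[i])) Normc.normc1 mul1r.
Qed.

(** An ultrafilter on the set has coordinatewise limits [ys]. Both defining bounds pass to [ys], and
    the common tail bound upgrades coordinatewise convergence to norm convergence. *)
Lemma compact_hahn_uniform_tail (M : R) : compact (hahn_uniform_tail M).
Proof.
rewrite compact_ultra /= => F FU FM.
have /choice[ys ysP] : forall k, exists a : R[i], forall e, 0 < e ->
    F [set y : hahn R | normc (y k - a) < e].
  move=> k; apply: (@ultrafilter_complex_limit _ _ F FU _ M).
  apply: filterS FM => y [yM _] /=.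
  exact: le_trans (normc_le_hahn_head1 y (leqnn k)) (yM k).
have headP N e : 0 < e ->
    F [set y : hahn R | hahn_head ((y : nat -> R[i]) - ys) N <= e].
  elim: N e => [|N IH] e e0.
    by apply: filterS (ysP 0%N e e0) => y /= /ltW yk; rewrite hahn_head_zero.
  (* The tolerances are chosen so that, after the factors 2 and [2 * N + 3] of [hahn_headS_le], each
     contributes [e / 2]. *)
  have e4 : 0 < e / 4 by rewrite divr_gt0.
  have eN : 0 < e / 2 / (2 * N + 3)%:R by rewrite !divr_gt0// ltr0n addnS.
  apply: filterS2 (IH _ e4) (ysP N.+1 _ eN) => y /= yN.
  rewrite ltr_pdivlMr ?ltr0n ?addnS// => /ltW yS.
  apply: le_trans (hahn_headS_le _ N) _; rewrite [_%:R * _]mulrC !addnS.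
  have -> : ((y : nat -> R[i]) - ys) N.+1 = y N.+1 - ys N.+1 by [].
  by lra.
have approx N n e : 0 < e -> exists y : hahn R, [/\ hahn_uniform_tail M y,
    hahn_head ((y : nat -> R[i]) - ys) N <= e &
    hahn_head ((y : nat -> R[i]) - ys) n <= e].
  move=> e0; have [y [[yM yN] yn]] :=
    filter_ex (filterI (filterI FM (headP N e e0)) (headP n e e0)).
  by exists y.
have ysM n : hahn_head ys n <= M.
  apply/ler_addgt0Pl => e e0; have [y [[yM _] _ yn]] := approx n n e e0.
  rewrite -[ys](subKr (y : nat -> R[i])).
  apply: le_trans (hahn_headB _ _ _) _.
  by rewrite addrC lerD// hahn_headBC.
have ysh : ys \in @hahn_pred R by exact: hahn_space_bounded ysM.
have ys_tail N n : (N <= n)%N ->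
    series (hahn_term ys) n <= series (hahn_term ys) N + M / N.+1%:R.
  move=> Nn; apply/ler_addgt0Pl => e e0.
  have e2 : 0 < e / 2 by rewrite divr_gt0.
  have [y [[_ ytail] yN yn]] := approx N n _ e2.
  have := hahn_seriesB y ys N; have := hahn_seriesB ys y n.
  rewrite [hahn_head (ys - _) _]hahn_headBC; have := ytail N n Nn.
  by move: (M / _) => c; lra.
exists (Hahn ysh); split; first by [].
apply/cvgrPdist_le => e e0.
have er : e = ((complex.Re e)%:C)%C by case: e e0 => ? ? /= /andP[/eqP-> _].
rewrite er; have {}e0 : 0 < complex.Re e by rewrite -ltcR -er.
move: (complex.Re e) e0 => {er} {}e e0.
have e2 : 0 < e / 2 by rewrite divr_gt0.
(* The tails of [ys] and of [y] each cost [M / (N + 1)], together at most [e / 2]; the truncated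
   distance at [N] costs the other half. *)
have [N MN] := exists_divn_le (2 * M) e2.
apply: filterS2 FM (headP N _ e2) => y [_ ytail] /= yN.
rewrite rnormE lecR; apply: rnorm_hahn_le => n.
have -> : Hahn ysh - y = ys - (y : nat -> R[i]) :> (nat -> R[i]) by [].
have ysyN : series (hahn_term (ys - (y : nat -> R[i]))) N <= e / 2.
  by apply: le_trans yN; rewrite hahn_headBC hahn_series_le_head.
have [Nn|/ltnW nN] := leqP N n; last first.
  apply: le_trans (hahn_series_nondecreasing _ nN) _; lra.
have := hahn_tailB ys y Nn; have := ys_tail N n Nn; have := ytail N n Nn.
move: MN ysyN; rewrite -mulrA mulr_natl mulr2n.
by move: (M / _) => c; lra.
Qed.

End HahnCompactness.

(** * The operator on the Hahn space: boundedness and compactness *)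

Section CesaroOnHahn.
Variables (R : realType) (t : R).
Hypotheses (t_ge0 : 0 <= t) (t_lt1 : t < 1).
Implicit Types (x y : hahn R) (l : R[i]).

Local Notation normc := Normc.normc.

Lemma cesaro_op_hahn x : cesaro_op t x \in @hahn_pred R.
Proof.
apply: (@hahn_space_bounded _ _ ((1 + cesaro_bound t) * rnorm x)) => n.
apply: le_trans (cesaro_head_le t_ge0 t_lt1 x n) _.
rewrite ler_wpM2l ?hahn_head_le_rnorm// addr_ge0//.
exact: cesaro_bound_ge0.
Qed.

Definition cesaro_hahn x : hahn R := Hahn (cesaro_op_hahn x).

Local Notation T := cesaro_hahn.

Lemma hahn_ext x y : (x : nat -> R[i]) = y -> x = y.
Proof. exact: val_inj. Qed.

Lemma iter_cesaro_hahnE m x :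
  (iter m T x : nat -> R[i]) = iter m (cesaro_op t) x.
Proof. by elim: m => //= m ->. Qed.

Lemma cesaro_hahn_linear : linear T.
Proof. by move=> a x y; apply: hahn_ext; exact: cesaro_op_linear. Qed.

Lemma cesaro_hahn0 : T 0 = 0.
Proof. by apply: hahn_ext; have := cesaro_opB t 0 0; rewrite !subrr. Qed.

Lemma rnorm_cesaro_hahn_le x : rnorm (T x) <= (1 + cesaro_bound t) * rnorm x.
Proof.
have := cesaro_bound_ge0 t_lt1 => L0; apply: rnorm_hahn_head_le => n.
apply: le_trans (cesaro_head_le t_ge0 t_lt1 x n) _.
by rewrite ler_wpM2l ?hahn_head_le_rnorm// addr_ge0.
Qed.

Lemma cesaro_hahn_bounded : bounded_operator T.
Proof.
split; first exact: cesaro_hahn_linear.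
by exists (1 + cesaro_bound t); exact: rnorm_cesaro_hahn_le.
Qed.

(** The tail estimate places the image of the unit ball in [hahn_uniform_tail], with one constant
    serving for both the norm and the tails. *)
Lemma cesaro_hahn_compact : compact_operator T.
Proof.
have L0 := cesaro_bound_ge0 t_lt1.
apply: (@precompact_subset _ _ (hahn_uniform_tail (1 + cesaro_bound t))); last first.
  apply: compact_precompact; first exact: norm_hausdorff.
  exact: compact_hahn_uniform_tail.
move=> _ [x /= x1 <-]; have xn n : hahn_head x n <= 1.
  exact: le_trans (hahn_head_le_rnorm x n) x1.
split=> [n|N n Nn] /=.
  apply: le_trans (cesaro_head_le t_ge0 t_lt1 x n) _.
  by rewrite ler_piMr// addr_ge0.
apply: le_trans (hahn_series_le_head _ _) _.
apply: le_trans (cesaro_head_tail t_ge0 t_lt1 x Nn) _.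
rewrite lerD2l -mulrA [_^-1 * _]mulrC mulrA ler_wpM2r//.
apply: (@le_trans _ _ (cesaro_bound t)); last by rewrite lerDr.
by rewrite ler_piMr.
Qed.

(** * Point spectrum and spectrum *)

Lemma hahn_eigenvector_subproof m :
  cesaro_eigenvector t m \in @hahn_pred R.
Proof.
apply: (@eigenvector_hahn R t t_ge0 t_lt1 m.+1%:R^-1).
  by rewrite invr_eq0 pnatr_eq0.
exact: cesaro_eigenvectorE.
Qed.

Definition hahn_eigenvector m : hahn R := Hahn (hahn_eigenvector_subproof m).

Lemma hahn_eigenvector_diag m : hahn_eigenvector m m = 1.
Proof. by rewrite /= /cesaro_eigenvector binn subnn mul1r. Qed.

Lemma hahn_eigenvector_neq0 m : hahn_eigenvector m != 0.
Proof.
apply/eqP => v0; have := hahn_eigenvector_diag m; rewrite v0.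
by move=> /esym/eqP; rewrite oner_eq0.
Qed.

Lemma cesaro_hahn_eigenvector m :
  T (hahn_eigenvector m) = m.+1%:R^-1 *: hahn_eigenvector m.
Proof. apply: hahn_ext; exact: cesaro_eigenvectorE. Qed.

(** The finite estimate with zero right-hand side kills the coordinates of [x - y] up to any [N].
    Since [l = 0] is allowed, this also shows that 0 is not an eigenvalue. *)
Lemma cesaro_hahn_resolvent_inj l : ~ Lambda l ->
  injective (fun x => l *: x - T x).
Proof.
move=> lL x y xy; apply/eqP; rewrite -subr_eq0; apply/eqP/hahn_ext.
apply: hahn_head_eq0 => N; have [C _ xC] := resolvent_equation_head t_ge0 t_lt1 N lL.
apply: le_trans (xC _) _.
have -> : l *: (x - y : nat -> R[i]) - cesaro_op t (x - y : nat -> R[i]) =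
    ((l *: x - T x) - (l *: y - T y) : hahn R).
  change (l *: ((x : nat -> R[i]) - y) - cesaro_op t ((x : nat -> R[i]) - y) =
    (l *: (x : nat -> R[i]) - cesaro_op t x)
    - (l *: (y : nat -> R[i]) - cesaro_op t y)).
  rewrite cesaro_opB scalerBr !opprB addrACA [in RHS]addrACA; congr (_ + _).
  exact: addrC.
rewrite xy subrr (_ : hahn_head _ N = 0) ?mulr0//; exact: hahn_head0.
Qed.

Lemma cesaro_hahn_point_spectrum : point_spectrum T = Lambda.
Proof.
apply/seteqP; split=> [l [x x0 Tx]|_ [m _ <-]]; last first.
  exists (hahn_eigenvector m); first exact: hahn_eigenvector_neq0.
  exact: cesaro_hahn_eigenvector.
apply: contrapT => lL; move/eqP: x0; apply.
apply: (cesaro_hahn_resolvent_inj lL); rewrite Tx subrr scaler0 sub0r.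
by rewrite cesaro_hahn0 oppr0.
Qed.

Lemma resolvent_equation_solvable l (y : nat -> R[i]) : ~ Lambda0 l ->
  exists x : nat -> R[i], l *: x - cesaro_op t x = y.
Proof.
move=> lL; have l0 : l != 0 by apply/eqP => l0; apply: lL; right.
have ln n : l * n.+1%:R - 1 != 0.
  apply/eqP => /subr0_eq ln1; apply: lL; left; exists n => //.
  by apply: (@mulIf _ n.+1%:R); rewrite ?mulVf ?ln1 ?pnatr_eq0.
(* Here [w] is the sought [T x]: substituting [x = (y + w) / l] in the recursion for [T x] gives [(l
   (n + 2) - 1) w_{n+1} = y_{n+1} + l t (n + 1) w_n]. *)
pose w := fix w n : R[i] := if n is m.+1
  then (y n + l * (t%:C)%C * n%:R * w m) / (l * n.+1%:R - 1)
  else y 0%N / (l * 1%:R - 1).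
have scE (a b : R[i]) : a *: b = a * b by [].
exists (l^-1 *: (y + w)); rewrite scalerA divff// scale1r.
rewrite -(cesaro_op_unique (y := w)) ?addrK// => [|n].
  have := ln 0%N; rewrite !fctE scE/= mulr1 => l1.
  by field; rewrite l0 l1.
rewrite !fctE scE [w n.+1]/=; have := ln n.+1.
move: (w n) (y n.+1) (t%:C)%C (n.+1%:R : R[i]) (n.+2%:R : R[i]).
by move=> a b u r s sl; field; rewrite l0 sl.
Qed.

(** The uniform bound is used twice: it puts the formal solution in the Hahn space, and it bounds
    the inverse. *)
Lemma cesaro_hahn_resolvent l : ~ Lambda0 l -> resolvent_set T l.
Proof.
move=> lL; have lL' : ~ Lambda l by move=> ?; apply: lL; left.
have [C C0 xC] := resolvent_equation_bound t_ge0 t_lt1 lL.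
have /choice[S SP] : forall y, exists x, l *: x - T x = y.
  move=> y; have [x xy] := resolvent_equation_solvable y lL.
  have xh : x \in @hahn_pred R.
    apply: (@hahn_space_bounded _ _ (C * rnorm y)) => n; apply: xC => m.
    by rewrite xy hahn_head_le_rnorm.
  by exists (Hahn xh); apply: hahn_ext.
have inj := cesaro_hahn_resolvent_inj lL'.
exists S; split=> //; last first.
  by move=> x; apply: inj; rewrite SP.
split.
  move=> a x y; apply: inj; rewrite SP -{1}(SP x) -{1}(SP y).
  rewrite cesaro_hahn_linear scalerBr scalerDr !scalerA (mulrC a).
  by rewrite opprD addrACA.
exists C => y; apply: rnorm_hahn_head_le; apply: xC => n.
by have := hahn_head_le_rnorm y n; rewrite -{1}(SP y).
Qed.

Lemma cesaro_hahn_spectrum : spectrum T = Lambda0.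
Proof.
apply/seteqP; split=> [l lS|l].
  by apply: contrapT => lL; apply: lS; exact: cesaro_hahn_resolvent.
move=> [[m _ <-]|->] [S [[_ [M SM]] ST _]].
  move/eqP: (hahn_eigenvector_neq0 m); apply; apply: (can_inj ST).
  by rewrite cesaro_hahn_eigenvector subrr cesaro_hahn0 scaler0 subr0.
(* A bounded inverse [S] of [- T] would give [|v_m| <= M / (m + 1) * |v_m|]
   for the eigenvectors [v_m]. *)
have half0 : 0 < 2^-1 :> R by rewrite invr_gt0.
have [m mM] := exists_divn_le M half0.
set v := hahn_eigenvector m.
have := SM (0 *: v - T v); rewrite ST scale0r sub0r rnormN.
rewrite cesaro_hahn_eigenvector rnormZ Normc.normcV normc_nat mulrA.
have v0 := rnorm_gt0 (hahn_eigenvector_neq0 m); rewrite -/v in v0 *.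
rewrite -subr_le0 -{1}(mul1r (rnorm v)) -mulrBl pmulr_lle0//.
by move: mM; move: (M / _) => c; lra.
Qed.

(** * Powers, ergodic means and orbits *)

(** The projection onto the fixed line spanned by [(t^n)], along the coordinate [x 0], which the
    operator preserves. *)
Definition cesaro_limit x : hahn R := x 0%N *: hahn_eigenvector 0.

Local Notation P := cesaro_limit.

Lemma cesaro_limit_le x : rnorm (P x) <= rnorm (hahn_eigenvector 0) * rnorm x.
Proof.
by rewrite rnormZ mulrC ler_wpM2l ?rnorm_ge0// normc_le_rnorm.
Qed.

Lemma cesaro_limit_bounded : bounded_operator P.
Proof.
split; last by exists (rnorm (hahn_eigenvector 0)); exact: cesaro_limit_le.
by move=> a x y; rewrite /P scalerA -scalerDl.
Qed.

Lemma iter_cesaro_hahn_linear m : linear (iter m T).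
Proof.
elim: m => [//|m IH] a x y /=; by rewrite IH cesaro_hahn_linear.
Qed.

Lemma iter_cesaro_limit m x : iter m T (P x) = P x.
Proof.
have TP : T (P x) = P x.
  rewrite /P -[_ *: _]addr0 cesaro_hahn_linear cesaro_hahn_eigenvector.
  rewrite invr1 scale1r; congr (_ + _).
  exact: cesaro_hahn0.
by elim: m => //= m ->.
Qed.

(** Since [P x] is fixed, the difference is the iterate of [x - P x], whose coordinate 0 vanishes,
    so the geometric decay applies. *)
Lemma iter_cesaro_hahn_cvg : exists2 C : R, 0 <= C &
  forall m x, rnorm (iter m T x - P x) <= C * (3 / 4) ^+ m * rnorm x.
Proof.
have [C C0 TC] := iter_cesaro_bound t_ge0 t_lt1.
pose A := 1 + rnorm (hahn_eigenvector 0).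
have A0 : 0 <= A by rewrite addr_ge0 ?rnorm_ge0.
exists (C * A) => [|m x]; first by rewrite mulr_ge0.
have -> : iter m T x - P x = iter m T (x - P x).
  rewrite -{1}(iter_cesaro_limit m x) addrC -scaleN1r -iter_cesaro_hahn_linear.
  by rewrite scaleN1r addrC.
apply: rnorm_hahn_head_le => n; rewrite iter_cesaro_hahnE.
rewrite [leRHS](_ : _ = C * (3 / 4) ^+ m * (A * rnorm x)); last by ring.
apply: TC => [|k].
  have -> : hahn_seq (x - P x) 0%N = x 0%N - x 0%N * hahn_eigenvector 0 0%N by [].
  by rewrite hahn_eigenvector_diag mulr1 subrr.
apply: le_trans (hahn_head_le_rnorm _ k) (le_trans (rnormB _ _) _).
by rewrite mulrDl mul1r lerD2l cesaro_limit_le.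
Qed.

Lemma cesaro_hahn_power_bounded : power_bounded T.
Proof.
have [C C0 TC] := iter_cesaro_hahn_cvg.
pose B := C + rnorm (hahn_eigenvector 0).
have B0 : 0 <= B by rewrite addr_ge0 ?rnorm_ge0.
apply: (@le_lt_trans _ _ B%:E); last exact: ltry.
apply: ge_ereal_sup => _ [m _ <-]; apply: opnorm_le => // x.
rewrite -(subrK (P x) (iter m T x)) (le_trans (rnormD _ _))//.
rewrite [leRHS]mulrDl; apply: lerD; last exact: cesaro_limit_le.
apply: le_trans (TC m x) _; apply: ler_wpM2r; first exact: rnorm_ge0.
by rewrite ler_piMr// exprn_ile1//; lra.
Qed.

Lemma cesaro_hahn_uniformly_mean_ergodic : uniformly_mean_ergodic T.
Proof.
have [C C0 TC] := iter_cesaro_hahn_cvg.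
exists P; first exact: cesaro_limit_bounded.
(* The bound 3 is the full sum [(3 / 4) / (1 - 3 / 4)]; hence the means approach [P] at rate
   [3 * C / n]. *)
have geo n : \sum_(1 <= m < n.+1) (3 / 4 : R) ^+ m <= 3.
  suff -> : \sum_(1 <= m < n.+1) (3 / 4 : R) ^+ m = 3 - 3 * (3 / 4) ^+ n.
    by rewrite gerBl mulr_ge0// exprn_ge0//; lra.
  elim: n => [|n IH]; first by rewrite big_geq// expr0; ring.
  by rewrite big_nat_recr//= IH exprS; field.
have mean_le n :
    (0 <= opnorm (fun x => (ergodic_mean T n.+1 x - P x)%R) <=
     (3 * C * harmonic n)%:E)%E.
  rewrite opnorm_ge0/=; apply: opnorm_le.
    by rewrite mulr_ge0 ?mulr_ge0// invr_ge0.
  move=> x; have n0 : n.+1%:R != 0 :> R[i] by rewrite pnatr_eq0.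
  have -> : ergodic_mean T n.+1 x - P x =
      n.+1%:R^-1 *: \sum_(1 <= m < n.+2) (iter m T x - P x).
    rewrite sumrB big_const_nat subSS subn0 iter_addr_0 scalerBr.
    by rewrite -(scaler_nat n.+1 (P x)) scalerA mulVf// scale1r.
  rewrite rnormZ Normc.normcV normc_nat /harmonic [_ * n.+1%:R^-1]mulrC -mulrA.
  rewrite ler_wpM2l//; apply: le_trans (rnorm_sum _ _ _) _.
  apply: (@le_trans _ _ (\sum_(1 <= m < n.+2) C * rnorm x * (3 / 4) ^+ m)).
    by apply: ler_sum => m _; rewrite (mulrAC C).
  rewrite -mulr_sumr mulrC -(mulrA 3) ler_wpM2r ?geo//.
  by rewrite mulr_ge0 ?rnorm_ge0.
(* The shift avoids the mean of index 0, where the factor [0^-1] has its default value 0. *)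
suff lim0 : opnorm (fun x => ergodic_mean T n.+1 x - P x) @[n --> \oo] --> 0%E.
  by rewrite -cvg_shiftS; exact: lim0.
apply: (squeeze_cvge (nearW _ mean_le)); first exact: cvg_cst.
apply: cvg_EFin; first by near=> n.
rewrite -[X in _ --> X](mulr0 (3 * C)).
by apply: cvgMr; exact: cvg_harmonic.
Unshelve. all: by end_near. Qed.

(* [y 1 - t * y 0] is an eigenfunctional for 1/2, and [y 0] one for 1, so on an
   orbit with scalars the former is dominated by the latter. *)
Lemma iter_cesaro_eigenfunctional m x :
  iter m T x 1%N - (t%:C)%C * iter m T x 0%N =
  2^-1 ^+ m * (x 1%N - (t%:C)%C * x 0%N).
Proof.
rewrite iter_cesaro_hahnE; elim: m => [|m IH]; first by rewrite mul1r.
rewrite exprS -mulrA -IH iterS; set z := iter m _ _.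
apply: (@mulfI _ 2); first by rewrite pnatr_eq0.
rewrite [RHS]mulVKf ?pnatr_eq0// mulrBr cesaro_opS !cesaro_op0.
by ring.
Qed.

Lemma dense_approx (D : set (hahn R)) x (e : R) : dense D -> 0 < e ->
  exists2 y, D y & rnorm (x - y) < e.
Proof.
move=> dD e0; have e0' : 0 < (e%:C)%C by rewrite ltcR.
have [||y [yx yD]] := dD (ball x (e%:C)%C)°.
- exists x; exact: nbhsx_ballx.
- exact: open_interior.
exists y => //; have /= := interior_subset yx.
by rewrite -ball_normE/= rnormE ltcR.
Qed.

(** If [x 0 = 0], the orbit stays at distance at least 1 from eigenvector 0. Otherwise approximate
    eigenvector 1, with coordinates 0 and 1 equal to 0 and 1: a small [y 0] forces a small scalar
    [l], hence a small [y 1 - t * y 0], against [y 1] near 1. *)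
Lemma cesaro_hahn_not_supercyclic : ~ supercyclic T.
Proof.
move=> [x dx].
have iter0 m : iter m T x 0%N = x 0%N.
  by rewrite iter_cesaro_hahnE iter_cesaro_op0.
have [x0|x0] := eqVneq (x 0%N) 0.
  have [_ [l [n ->]]] := dense_approx (hahn_eigenvector 0) dx ltr01.
  apply/negP; rewrite -leNgt; apply: le_trans (normc_le_rnorm _ 0).
  rewrite (_ : hahn_seq _ _ = 1 - l * iter n T x 0%N).
    by rewrite iter0 x0 mulr0 subr0 Normc.normc1.
  by rewrite -(hahn_eigenvector_diag 0).
pose a := normc (x 0%N); pose b := normc (x 1%N - (t%:C)%C * x 0%N).
have a0 : 0 < a.
  rewrite lt_neqAle normc_ge0 andbT eq_sym.
  by apply: contra x0 => /eqP/Normc.eq0_normc ->.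
have b0 : 0 <= b by exact: normc_ge0.
(* This [e] solves [2 * e + e * b / a = 1], which contradicts the strict form of the final
   three-term estimate of 1. *)
pose e := a / (2 * a + b); have d0 : 0 < 2 * a + b by lra.
have e0 : 0 < e by rewrite divr_gt0.
have [y [l [n yE]] ye] := dense_approx (hahn_eigenvector 1) dx e0.
have y0 : normc (y 0%N) < e.
  rewrite -normcN; apply: le_lt_trans ye; apply: le_trans (normc_le_rnorm _ 0).
  rewrite (_ : hahn_seq (_ - _) 0%N = hahn_eigenvector 1 0%N - y 0%N)//.
  by rewrite /= /cesaro_eigenvector bin0n mul0r sub0r.
have y1 : normc (1 - y 1%N) < e.
  apply: le_lt_trans ye; apply: le_trans (normc_le_rnorm _ 1).
  by rewrite -(hahn_eigenvector_diag 1).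
have y0E : normc (y 0%N) = normc l * a.
  by rewrite yE (_ : hahn_seq _ _ = l * iter n T x 0%N)// iter0 Normc.normcM.
have yfE : normc (y 1%N - (t%:C)%C * y 0%N) <= normc l * b.
  rewrite yE (_ : hahn_seq _ 1%N = l * iter n T x 1%N)//.
  rewrite (_ : hahn_seq _ 0%N = l * iter n T x 0%N)//.
  rewrite mulrCA -mulrBr iter_cesaro_eigenfunctional !Normc.normcM.
  rewrite ler_wpM2l ?normc_ge0// ler_piMl//.
  elim: n {yE} => [|n IH]; first by rewrite expr0 Normc.normc1.
  rewrite exprS Normc.normcM mulr_ile1 ?normc_ge0//.
  by rewrite Normc.normcV normc_nat invf_le1// ler1n.
have : 1 <= normc (1 - y 1%N) + normc (y 1%N - (t%:C)%C * y 0%N) + normc (y 0%N).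
  rewrite -{1}(Normc.normc1 R).
  have e1 : 1 = (1 - y 1%N) + (y 1%N - (t%:C)%C * y 0%N) + (t%:C)%C * y 0%N.
    by rewrite addrA !subrK.
  rewrite {1}e1; apply: le_trans (normc_addr _ _) _; apply: lerD.
    exact: normc_addr.
  by rewrite normc_t_mul// ler_piMl ?normc_ge0// ltW.
have le_la : normc l * a < e by rewrite -y0E.
have lb : normc l * b * a <= e * b.
  by rewrite mulrAC ler_wpM2r// ltW.
have eE : e * (2 * a + b) = a by rewrite mulfVK// gt_eqF.
nra.
Qed.

End CesaroOnHahn.

Theorem proposition12p1 (R : realType) (t : R) (t_ge0 : 0 <= t) (t_lt1 : t < 1) :
  exists2 T : hahn R -> hahn R,
    (forall (x : hahn R) (n : nat), T x n = cesaro_op t x n) &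
    [/\ bounded_operator T,
        compact_operator T,
        point_spectrum T = Lambda,
        spectrum T = Lambda0 &
        [/\ power_bounded T,
            uniformly_mean_ergodic T &
            ~ supercyclic T]].
Proof.
exists (cesaro_hahn t_ge0 t_lt1) => //; split.
- exact: cesaro_hahn_bounded.
- exact: cesaro_hahn_compact.
- exact: cesaro_hahn_point_spectrum.
- exact: cesaro_hahn_spectrum.
- split.
  + exact: cesaro_hahn_power_bounded.
  + exact: cesaro_hahn_uniformly_mean_ergodic.
  + exact: cesaro_hahn_not_supercyclic.
Qed.
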